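(* Let $M$ be a tractable metric space. Then the following hold. 1. $\mathrm{Cmp}_+(M)$ is a completion of $\mathrm{Fin}_+(M)$ (both with the Hausdorff metric). 2. The map $\mathrm{mag}\colon \mathrm{Cmp}_+(M)\to\mathbb{R}$ is uniformly continuous if and only if the map $\mathrm{mag}\colon \mathrm{Fin}_+(M)\to\mathbb{R}$ is uniformly continuous. Likewise, for every real $C\ge 0$, the map $\mathrm{mag}\colon \mathrm{Cmp}_+(M)\to\mathbb{R}$ is $C$-Lipschitz if and only if the map $\mathrm{mag}\colon \mathrm{Fin}_+(M)\to\mathbb{R}$ is $C$-Lipschitz. 3. The following statements are equivalent: (a) the map $\mathrm{mag}\colon \mathrm{Cmp}_+(M)\to\mathbb{R}$ is continuous; (b) for every bounded subspace $B\subseteq M$, the map $\mathrm{mag}\colon \mathrm{Fin}_+(B)\to\mathbb{R}$ is uniformly continuous; (c) for every $x\in M$ and every real $r>0$, the map $\mathrm{mag}\colon \mathrm{Fin}_+\big(\overline{B}_M(x,r)\big)\to\mathbb{R}$ is uniformly continuous. If any (and thus all) of (a), (b), (c) hold, then $\mathrm{mag}\colon \mathrm{Fin}_+(M)\to\mathbb{R}$ is continuous.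
   Context: For a finite metric space $F=\{a_1,\dots,a_n\}$ (distinct points) with metric $d$, its similarity matrix is $Z_F\in\mathbb{R}^{n\times n}$ with $(Z_F)_{ij}=e^{-d(a_i,a_j)}$. A metric space is positive definite if every finite subspace has a positive definite similarity matrix. For a finite positive definite space $F$, its magnitude $\mathrm{mag}(F)$ is the sum of all entries of $Z_F^{-1}$ (so $\mathrm{mag}(\emptyset)=0$). For a compact positive definite space $K$, $\mathrm{mag}(K):=\sup\{\mathrm{mag}(F) : F\subseteq K \text{ finite}\}\in[0,\infty]$; this agrees with the previous definition when $K$ is finite. $\overline{B}_M(x,r)$ is the closed ball in $M$ with center $x$ and radius $r$. A metric space $M$ is tractable if it is positive definite and, for every $x\in M$ and real $r>0$, the closed ball $\overline{B}_M(x,r)$ is compact and has finite magnitude (hence every compact subset of $M$ has finite magnitude). $\mathrm{Fin}_+(A)$ is the set of non-empty finite subsets of $A$ and $\mathrm{Cmp}_+(A)$ the set of non-empty compact subsets of $A$, both equipped with the Hausdorff metric $d_H$. Each subset is regarded as a metric space with the restricted metric when its magnitude is taken. *)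

(* Defs.v *)
From HB Require Import structures.
From mathcomp Require Import all_boot all_order all_algebra finmap.
From mathcomp Require Import all_classical all_reals all_analysis.

Set Implicit Arguments.
Unset Strict Implicit.
Unset Printing Implicit Defensive.

Import Order.TTheory GRing.Theory Num.Theory.
Import numFieldNormedType.Exports.

Local Open Scope classical_set_scope.
Local Open Scope ring_scope.

Section Magnitude.
Context {R : realType}.

Definition posdefmx (n : nat) (Z : 'M[R]_n) : Prop :=
  Z^T = Z /\ forall v : 'rV[R]_n, v != 0 -> 0 < (v *m Z *m v^T) 0 0.

Context {M : metricType R}.

Definition similarity_mx (F : {fset M}) : 'M[R]_(#|` F|) :=
  \matrix_(i, j)
    expR (- mdist (tnth (in_tuple (enum_fset F)) i)
                  (tnth (in_tuple (enum_fset F)) j)).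

Definition fin_mag (F : {fset M}) : R :=
  \sum_i \sum_j (invmx (similarity_mx F)) i j.

Definition mag (K : set M) : \bar R :=
  ereal_sup [set (fin_mag F)%:E | F in [set F : {fset M} | [set` F] `<=` K]].

(* This differs from the library's [closed_ball], the closure of the open
   ball, which in a general metric space can be smaller. *)
Definition cball (x : M) (r : R) : set M := [set y | mdist x y <= r].

Definition mbounded (B : set M) : Prop :=
  exists r : R, forall x y, B x -> B y -> mdist x y <= r.

Definition dist_set (x : M) (B : set M) : R := inf [set mdist x b | b in B].

Definition excess (A B : set M) : R := sup [set dist_set a B | a in A].

Definition hausdorff_dist (A B : set M) : R :=
  Num.max (excess A B) (excess B A).

End Magnitude.

Definition positive_definite {R : realType} (M : metricType R) : Prop :=
  forall F : {fset M}, posdefmx (similarity_mx F).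

Definition tractable {R : realType} (M : metricType R) : Prop :=
  positive_definite M /\
  forall (x : M) (r : R), 0 < r ->
    compact (cball x r) /\ (mag (cball x r) < +oo)%E.

Section HausdorffDist.
Context {R : realType} {M : metricType R}.
Implicit Types (x y : M) (A B C : set M).

Lemma compact_mbounded A : compact A -> mbounded A.
Proof.
move=> cA.
have bx x : exists r : R, forall y, A y -> mdist x y <= r.
  have /compact_near_coveringP cov := cA.
  have : \forall r \near (+oo : set_system R), A `<=` (fun y => mdist x y <= r).
    apply: (cov R +oo (fun r y => mdist x y <= r)) => a Aa.
    exists (ball a 1, [set r | mdist x a + 1 <= r]).
      split; first exact: nbhsx_ballx.
      exact: nbhs_pinfty_ge (num_real _).
    case=> y r /= []; rewrite ballEmdist /= => ay le_r.
    by rewrite (le_trans (metric_triangle x a y))// (le_trans _ le_r)// lerD2l ltW.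
  by case=> r [_ /(_ (r + 1))] Ar; exists (r + 1); apply: Ar; rewrite ltrDl.
have [[a Aa]|] := pselect (A !=set0); last first.
  by move=> nA; exists 0 => x y Ax; exfalso; apply: nA; exists x.
have [r ar] := bx a; exists (r + r) => x y Ax Ay.
rewrite (le_trans (metric_triangle x a y))// lerD ?ar//.
by rewrite metric_sym ar.
Qed.

Lemma dist_set_lb x B : has_lbound [set mdist x b | b in B].
Proof. by exists 0 => _ [b _ <-]; exact: mdist_ge0. Qed.

Lemma dist_set_le x B b : B b -> dist_set x B <= mdist x b.
Proof. by move=> Bb; apply: ge_inf; [exact: dist_set_lb|exists b]. Qed.

Lemma le_dist_set x B e : B !=set0 ->
  (forall b, B b -> e <= mdist x b) -> e <= dist_set x B.
Proof.
move=> [b0 Bb0] eB; apply: lb_le_inf; first by exists (mdist x b0), b0.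
by move=> _ [b Bb <-]; exact: eB.
Qed.

Lemma dist_set_triangle x y B : B !=set0 ->
  dist_set x B <= mdist x y + dist_set y B.
Proof.
move=> B0; rewrite -lerBlDl; apply: le_dist_set => // b Bb.
by rewrite lerBlDl (le_trans (dist_set_le x Bb))// metric_triangle.
Qed.

Lemma dist_set_eq0 x B : compact B -> B !=set0 -> dist_set x B <= 0 -> B x.
Proof.
move=> cB B0 dx.
have /closure_id -> := compact_closed (@metric_hausdorff R M) cB.
move=> U /nbhs_ballP [e /= e0 xeU].
have [b Bb] : exists2 b, B b & mdist x b < e.
  apply: contrapT => nb; suff : e <= dist_set x B.
    by move=> /le_trans/(_ dx); rewrite leNgt e0.
  apply: le_dist_set => // b Bb; rewrite leNgt; apply/negP => xb.
  by apply: nb; exists b.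
by exists b; split=> //; apply: xeU; rewrite ballEmdist.
Qed.

Lemma le_excess A B a : compact A -> B !=set0 -> A a ->
  dist_set a B <= excess A B.
Proof.
move=> /compact_mbounded[r Ar] [b Bb] Aa; apply: ub_le_sup; last by exists a.
exists (r + mdist a b) => _ [a' Aa' <-].
rewrite (le_trans (dist_set_le _ Bb))//.
by rewrite (le_trans (metric_triangle _ a _))// lerD2r Ar.
Qed.

Lemma excess_le A B e : A !=set0 ->
  (forall a, A a -> dist_set a B <= e) -> excess A B <= e.
Proof.
move=> [a Aa] AB; apply: ge_sup; first by exists (dist_set a B), a.
by move=> _ [a' Aa' <-]; exact: AB.
Qed.

Lemma excess_triangle A B C : compact A -> compact B ->
  A !=set0 -> B !=set0 -> C !=set0 ->
  excess A C <= excess A B + excess B C.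
Proof.
move=> cA cB A0 B0 C0; apply: excess_le => // a Aa.
rewrite -lerBlDr (le_trans _ (le_excess cA B0 Aa))//.
apply: le_dist_set => // b Bb; rewrite lerBlDr.
by rewrite (le_trans (dist_set_triangle a b C0))// lerD2l le_excess.
Qed.

Lemma hausdorff_dist_sym A B : hausdorff_dist A B = hausdorff_dist B A.
Proof. by rewrite /hausdorff_dist maxC. Qed.

Lemma hausdorff_distxx A : compact A -> A !=set0 -> hausdorff_dist A A = 0.
Proof.
move=> cA A0; rewrite /hausdorff_dist maxxx; apply/eqP; rewrite eq_le.
apply/andP; split.
  by apply: excess_le => // a Aa; rewrite -(mdistxx a) dist_set_le.
have [a Aa] := A0; apply: le_trans (le_excess cA A0 Aa).
by apply: le_dist_set => // b _; exact: mdist_ge0.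
Qed.

Lemma hausdorff_dist_eq0 A B : compact A -> compact B ->
  A !=set0 -> B !=set0 -> hausdorff_dist A B = 0 -> A = B.
Proof.
move=> cA cB A0 B0 AB.
have [AB0 BA0] : excess A B <= 0 /\ excess B A <= 0.
  by apply/andP; rewrite -ge_max -/(hausdorff_dist A B) AB.
apply/seteqP; split=> [a Aa|b Bb]; apply: dist_set_eq0 => //.
  exact: le_trans (le_excess cA B0 Aa) AB0.
exact: le_trans (le_excess cB A0 Bb) BA0.
Qed.

Lemma hausdorff_dist_triangle B A C : compact A -> compact B -> compact C ->
  A !=set0 -> B !=set0 -> C !=set0 ->
  hausdorff_dist A C <= hausdorff_dist A B + hausdorff_dist B C.
Proof.
move=> cA cB cC A0 B0 C0; rewrite /hausdorff_dist ge_max; apply/andP; split.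
  rewrite (le_trans (excess_triangle cA cB A0 B0 C0))//.
  by rewrite lerD// le_max lexx.
rewrite (le_trans (excess_triangle cC cB C0 B0 A0))// addrC.
by rewrite lerD// le_max lexx orbT.
Qed.

End HausdorffDist.

Section Hyperspaces.
Context {R : realType} {M : metricType R}.

Record cmp_plus (A : set M) := CmpPlus {
  cmp_val :> set M ;
  cmp_compact : compact cmp_val ;
  cmp_neq0 : cmp_val !=set0 ;
  cmp_sub : cmp_val `<=` A }.

Record fin_plus (A : set M) := FinPlus {
  fin_val :> {fset M} ;
  fin_neq0 : [set` fin_val] !=set0 ;
  fin_sub : [set` fin_val] `<=` A }.

Lemma cmp_val_inj A : injective (@cmp_val A).
Proof.
move=> [K Kc K0 KA] [L Lc L0 LA] /= eqKL; case: _ / eqKL Lc L0 LA => *.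
by congr CmpPlus; exact: Prop_irrelevance.
Qed.

Lemma fin_val_inj A : injective (@fin_val A).
Proof.
move=> [F F0 FA] [G G0 GA] /= eqFG; case: _ / eqFG G0 GA => *.
by congr FinPlus; exact: Prop_irrelevance.
Qed.

Lemma fset_compact (F : {fset M}) : compact [set` F].
Proof. by apply: finite_compact; exact: finite_fset. Qed.

Definition cmp_of_fin A (F : fin_plus A) : cmp_plus A :=
  CmpPlus (@fset_compact F) (@fin_neq0 A F) (@fin_sub A F).

Definition cmp_mdist A (K L : cmp_plus A) : R := hausdorff_dist K L.

Definition fin_mdist A (F G : fin_plus A) : R :=
  hausdorff_dist [set` fin_val F] [set` fin_val G].

Fact cmp_mdistxx A (K : cmp_plus A) : cmp_mdist K K = 0.
Proof. by apply: hausdorff_distxx; [exact: cmp_compact|exact: cmp_neq0]. Qed.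

Fact cmp_mdist_positivity A (K L : cmp_plus A) : cmp_mdist K L = 0 -> K = L.
Proof.
move=> KL; apply: cmp_val_inj.
by apply: hausdorff_dist_eq0 KL; [exact: cmp_compact|exact: cmp_compact
  |exact: cmp_neq0|exact: cmp_neq0].
Qed.

Fact cmp_mdist_sym A (K L : cmp_plus A) : cmp_mdist K L = cmp_mdist L K.
Proof. exact: hausdorff_dist_sym. Qed.

Fact cmp_mdist_triangle A (L K N : cmp_plus A) :
  cmp_mdist K N <= cmp_mdist K L + cmp_mdist L N.
Proof.
by apply: hausdorff_dist_triangle; do ?[exact: cmp_compact|exact: cmp_neq0].
Qed.

HB.instance Definition _ A := gen_eqMixin (cmp_plus A).
HB.instance Definition _ A := gen_choiceMixin (cmp_plus A).
HB.instance Definition _ A := @isMetric.Build R (cmp_plus A) (@cmp_mdist A)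
  (@cmp_mdistxx A) (@cmp_mdist_positivity A) (@cmp_mdist_sym A)
  (@cmp_mdist_triangle A).

Fact fin_mdistxx A (F : fin_plus A) : fin_mdist F F = 0.
Proof. exact: (cmp_mdistxx (cmp_of_fin F)). Qed.

Fact fin_mdist_positivity A (F G : fin_plus A) : fin_mdist F G = 0 -> F = G.
Proof.
move=> /(@cmp_mdist_positivity A (cmp_of_fin F) (cmp_of_fin G)).
move=> /(congr1 (@cmp_val A)) /= FG; apply: fin_val_inj.
by apply/fsetP => x; apply/idP/idP; case/seteqP: FG => FG GF;
  [exact: FG|exact: GF].
Qed.

Fact fin_mdist_sym A (F G : fin_plus A) : fin_mdist F G = fin_mdist G F.
Proof. exact: hausdorff_dist_sym. Qed.

Fact fin_mdist_triangle A (G F H : fin_plus A) :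
  fin_mdist F H <= fin_mdist F G + fin_mdist G H.
Proof.
exact: (@cmp_mdist_triangle A (cmp_of_fin G) (cmp_of_fin F) (cmp_of_fin H)).
Qed.

HB.instance Definition _ A := gen_eqMixin (fin_plus A).
HB.instance Definition _ A := gen_choiceMixin (fin_plus A).
HB.instance Definition _ A := @isMetric.Build R (fin_plus A) (@fin_mdist A)
  (@fin_mdistxx A) (@fin_mdist_positivity A) (@fin_mdist_sym A)
  (@fin_mdist_triangle A).

Lemma cmp_mdistE A (K L : cmp_plus A) : mdist K L = hausdorff_dist K L.
Proof. by []. Qed.

Lemma fin_mdistE A (F G : fin_plus A) :
  mdist F G = hausdorff_dist [set` fin_val F] [set` fin_val G].
Proof. by []. Qed.

Definition mag_fin (A : set M) (F : fin_plus A) : R := fin_mag F.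

(* In a tractable space [mag K] is finite for compact [K], so [fine] loses
   nothing there. *)
Definition mag_cmp (A : set M) (K : cmp_plus A) : R := fine (mag K).

End Hyperspaces.

Section MetricNotions.
Context {R : realType}.

Definition metric_complete (Y : metricType R) : Prop :=
  forall u : nat -> Y, cauchy (u n @[n --> \oo]) ->
    exists y : Y, u n @[n --> \oo] --> y.

Definition is_completion (X Y : metricType R) (i : X -> Y) : Prop :=
  [/\ metric_complete Y,
      forall x y : X, mdist (i x) (i y) = mdist x y
    & dense (range i)].

(* The library's Lipschitz predicates need normed modules. *)
Definition lipschitz_fun (C : R) (X : metricType R) (f : X -> R) : Prop :=
  forall x y : X, `|f x - f y| <= C * mdist x y.

End MetricNotions.

(* Main.v *)
Require Import Defs.
From mathcomp Require Import all_boot all_order all_algebra finmap.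
From mathcomp Require Import all_classical all_reals all_analysis.
From mathcomp Require Import ring lra.
Set Implicit Arguments.
Unset Strict Implicit.
Unset Printing Implicit Defensive.

Import Order.TTheory GRing.Theory Num.Theory.
Import numFieldNormedType.Exports.
Local Open Scope classical_set_scope.
Local Open Scope ring_scope.

(** Everything rests on two facts.

    First, magnitude is monotone on finite subsets of a positive definite
    space ([fin_mag_mono]).  For F a subset of G with weightings wF and wG,
    the similarity form evaluated at wG - wF is mag G - mag F, and it is
    nonnegative.  Hence the supremum defining mag K, for K compact, is
    approached by finite subsets that can in addition be enlarged to be as
    close to K as desired in the Hausdorff metric ([fin_plus_approx]).  So the
    graph of mag on Fin+(A) is dense in the graph of mag on Cmp+(A), although
    mag need not be continuous.  Every estimate of the form
    |mag K - mag L| <= omega (d_H (K, L)) therefore passes from finite to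
    compact sets, up to an arbitrarily small error.  This gives the density of
    Fin+(M), statement 2, and (c) => (a): the compact sets close to K all lie
    in one closed ball, on which the uniform estimate is available.

    Second, the nonempty compact subsets of a compact set D form a compact
    space for the Hausdorff metric ([compact_cmp_plus], Blaschke's selection
    theorem).  An ultrafilter U of such subsets converges to the set K of those
    x in D whose distance to L tends to 0 along U.  As closed balls of M are
    compact and a Cauchy sequence of compact sets is bounded, this gives the
    completeness of Cmp+(M).  It also gives (a) => (b): a bounded B lies in a
    closed ball D, and a continuous function is uniformly continuous on the
    compact space of compact subsets of D (Heine-Cantor). *)

(** * Weightings and monotonicity of finite magnitude *)

Section FiniteMagnitude.
Context {R : realType}.

Lemma posdefmx_unit n (Z : 'M[R]_n) : posdefmx Z -> Z \in unitmx.
Proof.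
move=> [_ pd]; rewrite unitmxE unitfE; apply/negP => /det0P[v v0 vZ].
by have := pd v v0; rewrite vZ mul0mx mxE ltxx.
Qed.

Lemma posdefmx_ge0 n (Z : 'M[R]_n) (v : 'rV[R]_n) :
  posdefmx Z -> 0 <= (v *m Z *m v^T) 0 0.
Proof.
move=> [_ pd]; have [->|/pd/ltW//] := eqVneq v 0.
by rewrite !mul0mx mxE.
Qed.

Context {M : metricType R}.
Implicit Types F G : {fset M}.

(** The magnitude of F is the total mass of a weighting.  The weighting is a
    function on the whole space, so that the weightings of two finite sets can
    be compared without matching the indexings of their matrices. *)
Lemma exists_weighting F : similarity_mx F \in unitmx ->
  exists2 w : M -> R,
    forall x, x \in F -> \sum_(y <- F) expR (- mdist x y) * w y = 1 &
    \sum_(y <- F) w y = fin_mag F.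
Proof.
move=> uZ; set t := tnth (in_tuple (enum_fset F)).
have t_inj : injective t by apply/tuple_uniqP; exact: fset_uniq.
pose W : 'cV[R]_(#|` F|) := invmx (similarity_mx F) *m const_mx 1.
(* At most one index i has t i = y, so the sum just reads off the entry of W. *)
pose w y := \sum_(i | t i == y) W i 0.
have wt i : w (t i) = W i 0.
  rewrite /w (eq_bigl (pred1 i)) ?big_pred1_eq// => j.
  by rewrite /= (inj_eq t_inj).
exists w => [x xF|].
  have /tnthP[i ->] : x \in in_tuple (enum_fset F) by [].
  rewrite big_tnth -/t; transitivity ((similarity_mx F *m W) i 0).
    by rewrite mxE; apply: eq_bigr => j _; rewrite wt [similarity_mx _ _ _]mxE.
  by rewrite mulKVmx// mxE.
rewrite big_tnth -/t; apply: eq_bigr => i _; rewrite wt mxE.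
by apply: eq_bigr => j _; rewrite [const_mx _ _ _]mxE mulr1.
Qed.

Lemma similarity_form_ge0 F (v : M -> R) : posdefmx (similarity_mx F) ->
  0 <= \sum_(x <- F) v x * \sum_(y <- F) expR (- mdist x y) * v y.
Proof.
move=> pd; set t := tnth (in_tuple (enum_fset F)).
apply: le_trans (posdefmx_ge0 (\row_i v (t i)) pd) _.
rewrite le_eqVlt; apply/orP; left; apply/eqP.
rewrite -mulmxA mxE [RHS]big_tnth -/t; apply: eq_bigr => i _; rewrite !mxE.
rewrite [in RHS]big_tnth -/t; congr *%R.
by apply: eq_bigr => j _; rewrite !mxE.
Qed.

(** With u the weighting of F extended by 0 and v = wG - u, the similarity
    form at v is mag G - mag F: the similarity matrix of G sends v to a vector
    that vanishes on F, so u pairs to 0 with it, and pairing with wG gives the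
    total mass of v. *)
Lemma fin_mag_mono F G : positive_definite M -> (F `<=` G)%fset ->
  fin_mag F <= fin_mag G.
Proof.
move=> pd FG.
have [wF wF1 <-] := exists_weighting (posdefmx_unit (pd F)).
have [wG wG1 <-] := exists_weighting (posdefmx_unit (pd G)).
pose u y := if y \in F then wF y else 0.
have restr (f : M -> R) : \sum_(y <- G) f y * u y = \sum_(y <- F) f y * wF y.
  rewrite -(big_fset_incl _ FG) => [|y _ yF]; last by rewrite /u (negbTE yF) mulr0.
  by apply: eq_big_seq => y yF; rewrite /u yF.
have := similarity_form_ge0 (fun y => wG y - u y) (pd G).
(* S x is the value at x of the similarity matrix applied to u. *)
pose S x := \sum_(y <- F) expR (- mdist x y) * wF y.
rewrite (eq_big_seq (fun x => wG x - wG x * S x - (1 - S x) * u x)); last first.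
  move=> x xG /=.
  under eq_bigr do rewrite mulrBr.
  rewrite sumrB wG1// restr -/(S x); ring.
rewrite !sumrB restr [X in _ - X]big1_seq ?subr0; last first.
  by move=> x /= xF; rewrite /S wF1// subrr mul0r.
suff -> : \sum_(x <- G) wG x * S x = \sum_(x <- F) wF x by rewrite subr_ge0.
under eq_bigr do rewrite mulr_sumr.
rewrite exchange_big/=; apply: eq_big_seq => y yF.
transitivity (wF y * \sum_(x <- G) expR (- mdist y x) * wG x).
  rewrite mulr_sumr; apply: eq_bigr => x _; rewrite metric_sym; ring.
by rewrite wG1 ?mulr1//; exact: (fsubsetP FG).
Qed.

End FiniteMagnitude.

(** * Finite nets and Hausdorff estimates *)

Section MetricLemmas.
Context {R : realType} {M : metricType R}.
Implicit Types A B K : set M.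

(** Total boundedness, obtained by near covering along the filter of finite
    subsets of K ordered by inclusion: every point of K is eventually within e
    of the finite set, hence all points are simultaneously. *)
Lemma compact_fset_net K (e : R) : compact K -> 0 < e ->
  exists2 F : {fset M}, [set` F] `<=` K &
    forall x, K x -> exists2 y, y \in F & mdist x y < e.
Proof.
move=> /compact_near_coveringP cK e0.
pose Phi : set_system {fset M} := filter_from
  [set F : {fset M} | [set` F] `<=` K]
  (fun F => [set G : {fset M} | (F `<=` G)%fset]).
have Phi_filter : Filter Phi.
  apply: filter_from_filter; first by exists fset0 => x.
  move=> F G FK GK; exists (F `|` G)%fset.
    by move=> x /=; rewrite inE => /orP[/FK|/GK].
  by move=> H; rewrite /= fsubUset => /andP[].
have [|F FK FG] := cK _ Phi (fun G x => exists2 y, y \in G & mdist x y < e) _.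
  move=> x Kx; exists (ball x e, [set G : {fset M} | x \in G]).
    split; first exact: nbhsx_ballx.
    exists [fset x]%fset; first by move=> y /=; rewrite inE => /eqP ->.
    by move=> G /=; rewrite fsub1set.
  case=> y G [/= xy xG]; exists x => //.
  by move: xy; rewrite ballEmdist /= metric_sym.
by exists F => // x Kx; exact: (FG F (fsubset_refl F)).
Qed.

Lemma hausdorff_dist_le A B (e : R) : A !=set0 -> B !=set0 ->
  (forall a, A a -> exists2 b, B b & mdist a b <= e) ->
  (forall b, B b -> exists2 a, A a & mdist b a <= e) ->
  hausdorff_dist A B <= e.
Proof.
move=> A0 B0 AB BA; rewrite /hausdorff_dist ge_max; apply/andP; split.
  apply: excess_le => // a /AB[b Bb]; apply: le_trans; exact: dist_set_le.
apply: excess_le => // b /BA[a Aa]; apply: le_trans; exact: dist_set_le.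
Qed.

Lemma dist_set_lt x B (e : R) : B !=set0 -> dist_set x B < e ->
  exists2 b, B b & mdist x b < e.
Proof.
move=> [b0 Bb0] xB; apply: contrapT => nb; move: xB; apply/negP.
rewrite -leNgt; apply: le_dist_set; first by exists b0.
by move=> b Bb; rewrite leNgt; apply/negP => xb; apply: nb; exists b.
Qed.

Lemma hausdorff_dist_lt A B (e : R) a : compact A -> B !=set0 -> A a ->
  hausdorff_dist A B < e -> exists2 b, B b & mdist a b < e.
Proof.
move=> cA B0 Aa; rewrite /hausdorff_dist gt_max => /andP[AB _].
by apply: dist_set_lt => //; apply: le_lt_trans AB; exact: le_excess.
Qed.

Lemma mbounded_cball (x : M) (r : R) : mbounded (cball x r).
Proof.
exists (r + r) => y z xy xz; rewrite (le_trans (metric_triangle y x z))//.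
by rewrite lerD// metric_sym.
Qed.

Lemma mbounded_sub_cball B x : mbounded B -> B x ->
  exists2 r : R, 0 < r & B `<=` cball x r.
Proof.
move=> [r Br] Bx; exists (Num.max 1 r); first by rewrite lt_max ltr01.
by move=> y By; rewrite /cball /= le_max Br ?orbT.
Qed.

End MetricLemmas.

(** * Uniform continuity on metric spaces *)

Section MetricContinuity.
Context {R : realType} {X : metricType R}.

Lemma unif_continuous_mdistP (f : X -> R) : unif_continuous f <->
  forall e, 0 < e -> exists2 d, 0 < d &
    forall x y, mdist x y < d -> `|f x - f y| < e.
Proof.
rewrite /unif_continuous -!entourage_from_ballE; split.
  move=> uf e e0.
  have [|d d0 df] := uf [set xy : R * R | ball xy.1 e xy.2]; first by exists e.
  exists d => // x y xy; have /= := df (x, y); rewrite ballEmdist; exact.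
move=> uf E [e e0 eE]; have [d d0 df] := uf e e0.
exists d => // -[x y]; rewrite /= ballEmdist /= => /df xy.
by apply: eE.
Qed.

Lemma continuous_mdistP (f : X -> R) : continuous f <->
  forall x e, 0 < e -> exists2 d, 0 < d &
    forall y, mdist x y < d -> `|f x - f y| < e.
Proof.
split=> [cf x e e0|cf x].
  have /cvgrPdist_lt/(_ e e0)/nbhs_ballP[d d0 df] := cf x.
  by exists d => // y xy; apply: df; rewrite ballEmdist.
apply/cvgrPdist_lt => e e0; have [d d0 df] := cf x e e0.
by apply/nbhs_ballP; exists d => // y; rewrite ballEmdist; exact: df.
Qed.

(** Heine-Cantor, in the form where only one of the two points has to lie in
    the compact set. *)
Lemma compact_unif_continuous (S : set X) (f : X -> R) :
  compact S -> continuous f ->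
  forall e, 0 < e -> exists2 d, 0 < d &
    forall x y, S x -> mdist x y < d -> `|f x - f y| < e.
Proof.
move=> /compact_near_coveringP cS /continuous_mdistP cf e e0.
have : \forall d \near 0^'+, S `<=`
    (fun x => forall y, mdist x y < d -> `|f x - f y| < e).
  apply: (cS R (0^'+) (fun d x => forall y, mdist x y < d -> `|f x - f y| < e)).
  move=> x _; have [|d d0 df] := cf x (e / 2); first by rewrite divr_gt0.
  have d20 : 0 < d / 2 by rewrite divr_gt0.
  exists (ball x (d / 2), [set t | t < d / 2]).
    by split; [exact: nbhsx_ballx|exact: nbhs_right_lt].
  case=> z t []; rewrite ballEmdist /= => xz td y zy.
  have xy : mdist x y < d.
    by rewrite (le_lt_trans (metric_triangle x z y))//; lra.
  have := df y xy; have := df z ltac:(lra).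
  rewrite [X in X < _ -> _]distrC => zx xy'.
  rewrite [e]splitr; apply: le_lt_trans (ltrD zx xy').
  by rewrite (le_trans _ (ler_normD _ _))// subrKA.
move=> dS; have [d []] := filter_ex (filterI dS (nbhs_right_gt (0 : R))).
by move=> Sd d0; exists d => // x y Sx; exact: Sd.
Qed.

End MetricContinuity.

(** * Approximating compact sets by finite ones, with their magnitude *)

Section CompactMagnitude.
Context {R : realType} {M : metricType R}.
Implicit Types (A K L : set M) (F G : {fset M}).

Lemma mag_le K L : K `<=` L -> (mag K <= mag L)%E.
Proof.
move=> KL; apply: le_ereal_sup => _ [F FK <-].
by exists F => //; exact: subset_trans KL.
Qed.

Lemma fin_mag_le_mag F K : [set` F] `<=` K -> ((fin_mag F)%:E <= mag K)%E.
Proof. by move=> FK; apply: ereal_sup_ubound; exists F. Qed.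

Lemma mag_fset F : positive_definite M -> mag [set` F] = (fin_mag F)%:E.
Proof.
move=> pd; apply/eqP; rewrite eq_le fin_mag_le_mag// andbT.
apply: ge_ereal_sup => _ [G GF <-]; rewrite lee_fin fin_mag_mono//.
by apply/fsubsetP => x xG; exact: GF.
Qed.

(** K sits in a closed ball, which has finite magnitude.  The bound from below
    is the magnitude of the empty set; this is what makes [fine] harmless in
    [mag_cmp]. *)
Lemma mag_compact_fin_num K : tractable M -> compact K -> mag K \is a fin_num.
Proof.
move=> [_ tM] cK; rewrite fin_numElt; apply/andP; split.
  apply: lt_le_trans (@fin_mag_le_mag fset0 _ _); first exact: ltNyr.
  by move=> x.
have [[x Kx]|K0] := pselect (K !=set0).
  have [r r0 Kr] := mbounded_sub_cball (compact_mbounded cK) Kx.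
  by have [_] := tM x r r0; apply: le_lt_trans; exact: mag_le.
apply: (@le_lt_trans _ _ (fin_mag (fset0 : {fset M}))%:E); last exact: ltry.
apply: ge_ereal_sup => _ [F FK <-]; suff -> : F = fset0 by [].
apply/fsetP => x; rewrite inE; apply/negP => xF.
by apply: K0; exists x; exact: FK.
Qed.

Lemma mag_cmp_of_fin A (F : fin_plus A) : positive_definite M ->
  mag_cmp (cmp_of_fin F) = mag_fin F.
Proof. by move=> pd; rewrite /mag_cmp /= mag_fset. Qed.

(** A finite subset of K of nearly maximal magnitude may be joined with a
    finite net of K: by monotonicity the magnitude can only grow towards
    mag K. *)
Lemma fin_plus_approx A (K : cmp_plus A) (e : R) : tractable M -> 0 < e ->
  exists2 F : fin_plus A, mdist (cmp_of_fin F) K < e &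
    `|mag_cmp K - mag_fin F| < e.
Proof.
move=> tM e0; have cK : compact K by exact: cmp_compact.
have Kfin := mag_compact_fin_num tM cK.
have [_ [F0 F0K <-] F0e] := ub_ereal_sup_adherent e0 Kfin.
have e20 : 0 < e / 2 by rewrite divr_gt0.
have [N NK Ne] := compact_fset_net cK e20.
pose F := (F0 `|` N)%fset.
have FK : [set` F] `<=` K by move=> x /=; rewrite inE => /orP[/F0K|/NK].
have Fnet x : cmp_val K x -> exists2 y, y \in F & mdist x y < e / 2.
  by move=> /Ne[y yN xy]; exists y => //; rewrite inE yN orbT.
have F_neq0 : [set` F] !=set0.
  by have [x /Fnet[y yF _]] := cmp_neq0 K; exists y.
exists (FinPlus F_neq0 (subset_trans FK (@cmp_sub _ _ _ K))).
  rewrite cmp_mdistE /=; apply: (@le_lt_trans _ _ (e / 2)); last by lra.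
  apply: hausdorff_dist_le => //; first exact: cmp_neq0.
    by move=> x /FK Kx; exists x => //; rewrite mdistxx ltW.
  by move=> x /Fnet[y yF /ltW xy]; exists y.
have FmagK := fin_mag_le_mag FK.
have F0F : fin_mag F0 <= fin_mag F by apply: fin_mag_mono tM.1 (fsubsetUl _ _).
move: F0e FmagK; rewrite /mag_cmp /mag_fin /= -/(mag K) -{1 2}(fineK Kfin).
rewrite -EFinB lte_fin lee_fin => F0e FmagK.
by rewrite ger0_norm; lra.
Qed.

(** Any bound on the variation of mag between finite sets in terms of their
    Hausdorff distance is inherited by compact sets, up to e. *)
Lemma mag_cmp_fin_approx A (K L : cmp_plus A) (e : R) : tractable M -> 0 < e ->
  exists F G : fin_plus A, mdist F G < mdist K L + e /\
    `|mag_cmp K - mag_cmp L| < `|mag_fin F - mag_fin G| + e.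
Proof.
move=> tM e0; have e20 : 0 < e / 2 by rewrite divr_gt0.
have [F FK mF] := fin_plus_approx K tM e20.
have [G GL mG] := fin_plus_approx L tM e20.
exists F, G; split.
  have -> : mdist F G = mdist (cmp_of_fin F) (cmp_of_fin G) by [].
  have := metric_triangle (cmp_of_fin F) K (cmp_of_fin G).
  have := metric_triangle K L (cmp_of_fin G).
  by rewrite (metric_sym L); lra.
have -> : mag_cmp K - mag_cmp L =
  (mag_fin F - mag_fin G) + ((mag_cmp K - mag_fin F) - (mag_cmp L - mag_fin G)).
  ring.
apply: le_lt_trans (ler_normD _ _) _; rewrite ltrD2l.
by apply: le_lt_trans (ler_normB _ _) _; lra.
Qed.

Lemma unif_continuous_mag_cmp_fin A : tractable M ->
  unif_continuous (@mag_cmp R M A) <-> unif_continuous (@mag_fin R M A).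
Proof.
move=> tM.
split=> /unif_continuous_mdistP uc; apply/unif_continuous_mdistP => e e0.
  have [d d0 df] := uc e e0; exists d => // F G FG.
  by rewrite -!(mag_cmp_of_fin _ tM.1); exact: df.
have e20 : 0 < e / 2 by rewrite divr_gt0.
have [d d0 df] := uc _ e20; exists (d / 2) => [|K L KL].
  by rewrite divr_gt0.
pose t := Num.min (d / 2) (e / 2).
have t0 : 0 < t by rewrite lt_min !divr_gt0.
have [F [G [FG mFG]]] := mag_cmp_fin_approx K L tM t0.
have td : t <= d / 2 by rewrite /t ge_min lexx.
have te : t <= e / 2 by rewrite /t ge_min lexx orbT.
by have := df F G ltac:(lra); lra.
Qed.

Lemma lipschitz_mag_cmp_fin A (C : R) : tractable M -> 0 <= C ->
  lipschitz_fun C (@mag_cmp R M A) <-> lipschitz_fun C (@mag_fin R M A).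
Proof.
move=> tM C0; split=> lip.
  by move=> F G; rewrite -!(mag_cmp_of_fin _ tM.1); exact: lip.
move=> K L; apply/ler_addgt0Pl => e e0.
(* The error e / (C + 1) enters once through the distance, multiplied by C,
   and once through the magnitudes. *)
have C1 : 0 < C + 1 by lra.
have t0 : 0 < e / (C + 1) by rewrite divr_gt0.
have [F [G [FG mFG]]] := mag_cmp_fin_approx K L tM t0.
have := lip F G; have := ler_wpM2l C0 (ltW FG).
have : C * (e / (C + 1)) + e / (C + 1) = e by field; lra.
rewrite mulrDr; lra.
Qed.

End CompactMagnitude.

(** * Compactness of the space of compact subsets *)

Section Hyperspace.
Context {R : realType} {M : metricType R}.
Implicit Types A D K : set M.

Lemma closed_far_set K (c : R) : closed [set y | forall x, K x -> c <= mdist y x].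
Proof.
move=> y cy x Kx; rewrite leNgt; apply/negP => yx.
have c0 : 0 < c - mdist y x by rewrite subr_gt0.
have [z [/(_ x Kx) cz]] := cy _ (nbhsx_ballx y _ c0).
rewrite ballEmdist /= => yz; have := metric_triangle z y x.
by rewrite (metric_sym z y); lra.
Qed.

(** Blaschke's selection theorem.  The limit of an ultrafilter U of compact
    subsets of D is K = {x in D | dist_set x L tends to 0 along U}.  A point of
    D outside K has a neighbourhood that U-almost every L avoids; by near
    covering so has any compact part of D disjoint from K ([avoid]).  Applied
    to D this shows that K is not empty, and applied to the points of D far
    from K it shows that L is eventually close to K.  Conversely K is
    eventually close to L by near covering on K. *)
Lemma compact_cmp_plus A D : compact D -> D `<=` A ->
  compact [set L : cmp_plus A | L `<=` D].
Proof.
move=> cD DA; rewrite compact_ultra => U UU UD.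
pose K := [set x | D x /\
  forall e, 0 < e -> U [set L : cmp_plus A | dist_set x L < e]].
have avoid D' : compact D' -> D' `<=` D -> (forall x, D' x -> ~ K x) ->
    \forall L \near U, D' `<=` (fun y => ~ cmp_val L y).
  move=> /compact_near_coveringP cD' D'D D'K.
  apply: (cD' _ U (fun (L : cmp_plus A) y => ~ cmp_val L y)) => x D'x.
  have [e e0 far] :
      exists2 e : R, 0 < e & ~ U [set L : cmp_plus A | dist_set x L < e].
    apply: contrapT => nfar; apply: (D'K x D'x); split; first exact: D'D.
    by move=> e e0; apply: contrapT => nU; apply: nfar; exists e.
  exists (ball x e, ~` [set L : cmp_plus A | dist_set x L < e]).
    split; first exact: nbhsx_ballx.
    (* [far] only says that a set is not in U; ultra gives its complement. *)
    by have [] := in_ultra_setVsetC [set L : cmp_plus A | dist_set x L < e] UU.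
  case=> y L [/= xy xL] Ly; apply: xL; apply: le_lt_trans (dist_set_le x Ly) _.
  by move: xy; rewrite ballEmdist.
have KD : K `<=` D by move=> x [].
have clK : closed K.
  move=> x cx; split.
    apply: (compact_closed (@metric_hausdorff R M) cD).
    exact: closure_subset cx.
  move=> e e0; have e20 : 0 < e / 2 by rewrite divr_gt0.
  have [y [[_ /(_ _ e20)]]] := cx _ (nbhsx_ballx x _ e20).
  rewrite ballEmdist /= => Uy xy; apply: filterS Uy => L /= yL.
  apply: le_lt_trans (dist_set_triangle x y (@cmp_neq0 _ _ _ L)) _.
  by lra.
have cK : compact K by exact: subclosed_compact cD KD.
have K0 : K !=set0.
  apply: contrapT => K0.
  have UL : \forall L \near U, D `<=` (fun y => ~ cmp_val L y).
    by apply: avoid => // x _ Kx; apply: K0; exists x.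
  have [L [LD nL]] := filter_ex (filterI UD UL).
  by have [y Ly] := @cmp_neq0 _ _ _ L; exact: nL (LD _ Ly) Ly.
exists (CmpPlus cK K0 (subset_trans KD DA)); split=> //= P /nbhs_ballP[e e0 eP].
have e20 : 0 < e / 2 by rewrite divr_gt0.
have UK : \forall L \near U,
    K `<=` (fun x => exists2 y, cmp_val L y & mdist x y <= e / 2).
  have /compact_near_coveringP covK := cK.
  apply: (covK _ U (fun (L : cmp_plus A) x =>
    exists2 y, cmp_val L y & mdist x y <= e / 2)) => x [_ Ux].
  have e40 : 0 < e / 4 by rewrite divr_gt0.
  exists (ball x (e / 4), [set L : cmp_plus A | dist_set x L < e / 4]).
    by split; [exact: nbhsx_ballx|exact: Ux].
  case=> z L []; rewrite ballEmdist /= => xz.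
  move=> /(dist_set_lt (@cmp_neq0 _ _ _ L))[y Ly xy]; exists y => //.
  have := metric_triangle z x y; rewrite (metric_sym z x); lra.
have UL : \forall L \near U,
    D `&` [set y | forall x, K x -> e / 2 <= mdist y x]
      `<=` (fun y => ~ cmp_val L y).
  apply: avoid => [||x [_ far] /far].
  - apply: (subclosed_compact _ cD); last exact: subIsetl.
    apply: closedI; last exact: closed_far_set.
    exact: compact_closed (@metric_hausdorff R M) cD.
  - exact: subIsetl.
  - by rewrite mdistxx leNgt e20.
apply: filterS (filterI UD (filterI UK UL)) => L [/= LD [KL LK]]; apply: eP.
rewrite ballEmdist /= cmp_mdistE /=; apply: (@le_lt_trans _ _ (e / 2)).
  apply: hausdorff_dist_le => //; first exact: cmp_neq0.
  move=> y Ly; apply: contrapT => far; apply: (LK y) (Ly); split; first exact: LD.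
  move=> x Kx; rewrite leNgt; apply/negP => /ltW yx; apply: far.
  by exists x.
lra.
Qed.

(** Sets close to a compact set stay in one ball, so local questions in
    Cmp+(M) reduce to the compact space Cmp+(D) for a closed ball D. *)
Lemma cmp_plus_near_sub_cball A (K : cmp_plus A) :
  exists x (r : R), 0 < r /\
    forall L : cmp_plus A, mdist K L < 1 -> L `<=` cball x r.
Proof.
have [x Kx] := @cmp_neq0 _ _ _ K.
have cK : compact K by exact: cmp_compact.
have [r r0 Kr] := mbounded_sub_cball (compact_mbounded cK) Kx.
exists x, (r + 1); split => [|L KL y Ly]; first by lra.
have cL : compact L by exact: cmp_compact.
have [|k Kk yk] := hausdorff_dist_lt (e := 1) cL (@cmp_neq0 _ _ _ K) Ly.
  by rewrite hausdorff_dist_sym.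
have := Kr k Kk; rewrite /cball /= => xk.
have := metric_triangle x k y; rewrite (metric_sym k y); lra.
Qed.

End Hyperspace.

(** * Cmp+(M) is a completion of Fin+(M) *)

Section Completeness.
Context {R : realType}.

Lemma compact_cauchy_seq_cvg (X : metricType R) (S : set X) (u : nat -> X) :
  compact S -> cauchy (u n @[n --> \oo]) -> (\forall n \near \oo, S (u n)) ->
  exists y : X, u n @[n --> \oo] --> y.
Proof.
move=> cS cu uS; have [y [_ uy]] := cS (u n @[n --> \oo]) _ uS.
exists y => P /nbhs_ballP[e e0 eP].
have e20 : 0 < e / 2 by rewrite divr_gt0.
have /cu[[V W] [/= uV uW] VW] :
    entourage [set xy : X * X | ball xy.1 (e / 2) xy.2].
  by rewrite -entourage_from_ballE; exists (e / 2).
have [v [Vv yv]] := uy _ _ uV (nbhsx_ballx y _ e20).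
apply: filterS uW => w Ww; apply: eP; rewrite [e]splitr.
by apply: ball_triangle yv _; exact: (VW (v, w)).
Qed.

Lemma metric_complete_cmp_plus (M : metricType R) : tractable M ->
  metric_complete (cmp_plus [set: M]).
Proof.
move=> [_ tM] u cu.
have /cu[[V W] [/= uV uW] VW] :
    entourage [set xy : cmp_plus [set: M] * cmp_plus [set: M] |
                ball xy.1 1 xy.2].
  by rewrite -entourage_from_ballE; exists 1; rewrite //= ltr01.
have [K VK] := filter_ex uV.
have [x [r [r0 Kr]]] := cmp_plus_near_sub_cball K.
apply: (compact_cauchy_seq_cvg _ cu).
  exact: (@compact_cmp_plus _ _ _ _ (tM x r r0).1).
apply: filterS uW => L WL; apply: Kr.
by have := VW (K, L) (conj VK WL); rewrite /= ballEmdist.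
Qed.

Lemma dense_cmp_of_fin (M : metricType R) : tractable M ->
  dense (range (@cmp_of_fin R M [set: M])).
Proof.
move=> tM O [K OK] Oo.
have /nbhs_ballP[e e0 eO] : nbhs K O by exact: open_nbhs_nbhs.
have [F FK _] := fin_plus_approx K tM e0.
exists (cmp_of_fin F); split; last by exists F.
by apply: eO; rewrite ballEmdist /= metric_sym.
Qed.

End Completeness.

(** * Continuity of magnitude *)

Section MagnitudeContinuity.
Context {R : realType} {M : metricType R}.
Context (tM : tractable M).

(** Finite subsets of B are points of the compact space of compact subsets of
    a closed ball containing B, where continuity is uniform. *)
Lemma continuous_mag_cmp_bounded (B : set M) :
  continuous (@mag_cmp R M [set: M]) -> mbounded B ->
  unif_continuous (@mag_fin R M B).
Proof.
move=> cmag bB; apply/unif_continuous_mdistP => e e0.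
have [[x Bx]|B0] := pselect (B !=set0); last first.
  exists 1 => // F; have [y Fy] := fin_neq0 F.
  by exfalso; apply: B0; exists y; exact: fin_sub Fy.
have [r r0 Br] := mbounded_sub_cball bB Bx.
have [d d0 df] := compact_unif_continuous
  (@compact_cmp_plus _ _ [set: M] _ (tM.2 x r r0).1 (@subsetT _ _)) cmag e0.
(* The same finite set, as a compact subset of the whole space. *)
pose wid (F : fin_plus B) :=
  cmp_of_fin (FinPlus (@fin_neq0 _ _ _ F) (@subsetT _ [set` fin_val F])).
have widE F : mag_cmp (wid F) = mag_fin F by exact: (mag_cmp_of_fin _ tM.1).
exists d => // F G FG; rewrite -!widE; apply: df => //.
by move=> y Fy; apply: Br; exact: (@fin_sub _ _ _ F _ Fy).
Qed.

(** All compact sets at distance less than 1 from K lie in one closed ball D,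
    and uniform continuity on Fin+(D) extends to Cmp+(D). *)
Lemma unif_cball_continuous_mag_cmp :
  (forall (x : M) (r : R), 0 < r -> unif_continuous (@mag_fin R M (cball x r))) ->
  continuous (@mag_cmp R M [set: M]).
Proof.
move=> uc; apply/continuous_mdistP => K e e0.
have [x [r [r0 Kr]]] := cmp_plus_near_sub_cball K.
have /(unif_continuous_mag_cmp_fin _ tM)/unif_continuous_mdistP/(_ e e0)
  [d d0 df] := uc x r r0.
exists (Num.min 1 d) => [|L]; first by rewrite lt_min ltr01.
rewrite lt_min => /andP[/Kr LD KL].
have KD : K `<=` cball x r by apply: Kr; rewrite mdistxx ltr01.
exact: (df (CmpPlus (@cmp_compact _ _ _ K) (@cmp_neq0 _ _ _ K) KD)
           (CmpPlus (@cmp_compact _ _ _ L) (@cmp_neq0 _ _ _ L) LD)).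
Qed.

Lemma continuous_mag_cmp_fin : continuous (@mag_cmp R M [set: M]) ->
  continuous (@mag_fin R M [set: M]).
Proof.
move=> /continuous_mdistP cmag; apply/continuous_mdistP => F e e0.
have [d d0 df] := cmag (cmp_of_fin F) e e0; exists d => // G FG.
by rewrite -!(mag_cmp_of_fin _ tM.1); exact: df.
Qed.

End MagnitudeContinuity.

Theorem proposition3p12 (R : realType) (M : metricType R) (HM : tractable M) :
  is_completion (@cmp_of_fin R M [set: M])
  /\
  ((unif_continuous (@mag_cmp R M [set: M]) <->
      unif_continuous (@mag_fin R M [set: M]))
   /\
   (forall C : R, 0 <= C ->
      (lipschitz_fun C (@mag_cmp R M [set: M]) <->
         lipschitz_fun C (@mag_fin R M [set: M]))))
  /\
  (let a := continuous (@mag_cmp R M [set: M]) in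
   let b := forall B : set M, mbounded B ->
              unif_continuous (@mag_fin R M B) in
   let c := forall (x : M) (r : R), 0 < r ->
              unif_continuous (@mag_fin R M (cball x r)) in
   ((a <-> b) /\ (b <-> c)) /\
   (a \/ b \/ c -> continuous (@mag_fin R M [set: M]))).
Proof.
have ab := continuous_mag_cmp_bounded HM.
have ca := unif_cball_continuous_mag_cmp HM.
split; first by split;
  [exact: metric_complete_cmp_plus|by []|exact: dense_cmp_of_fin].
split; first by split=> [|C C0];
  [exact: unif_continuous_mag_cmp_fin|exact: lipschitz_mag_cmp_fin].
move=> a b c.
have bc : b -> c by move=> hb x r _; exact: hb (mbounded_cball _ _).
have ca' : c -> a by exact: ca.
have ab' : a -> b by move=> ha B; exact: ab.
split; first by split; split=> //; [move=> /bc/ca'|move=> /ca'/ab'].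
by move=> abc; apply: (continuous_mag_cmp_fin HM); case: abc => [|[/bc/ca'|/ca']].
Qed.
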